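(* Let $\Gamma$ be a finite quantum group with dual $\hat\Gamma$ and Fourier transform $\Phi\colon l^2(\Gamma)\to l^2(\hat\Gamma)$, $\hat x:=\Phi(x)$. Let $\mathbf A$ be a quantum translation association scheme over $\Gamma$ corresponding to a quantum Schur ring $S\subseteq l^2(\Gamma)$, i.e. with Bose--Mesner algebra $\mathscr A=\{A_x\mid x\in S\}$. Then the set $$\hat{\mathscr A}:=\{A_{\hat x}\mid x\in S\}\subseteq\mathscr L(l^2(\hat\Gamma))$$ is the Bose--Mesner algebra of a quantum translation association scheme $\hat{\mathbf A}$ over $\hat\Gamma$, and $\hat{\mathbf A}$ is dual to $\mathbf A$.
   Context: All algebras are unital over $\mathbb C$. A finite quantum space $X$ is given by a nonzero finite-dimensional $*$-algebra $C(X)$ with a positive linear functional $\psi$ such that $(a,b)\mapsto\psi(ab)$ is non-degenerate, $\psi(ab)=\psi(ba)$, and $mm^\dagger=\mathrm{id}$, where $m\colon C(X)\otimes C(X)\to C(X)$ is the multiplication and $\dagger$ is the adjoint with respect to the inner product $\langle a,b\rangle=\psi(a^*b)$ (and the induced one on tensor powers). $l^2(X)$ is $C(X)$ as a Hilbert space with this inner product; $\eta$ is the unit of $C(X)$ (as a map $\mathbb C\to l^2(X)$ or a vector), so $\eta^\dagger=\psi$, and $n:=\eta^\dagger\eta=\dim C(X)$. For $A,B\in\mathscr L(l^2(X))$: $A^\dagger$ is the adjoint, $A^*(f):=(A(f^* ))^*$, the Schur product is $A\bullet B:=m(A\otimes B)m^\dagger$, $I$ is the identity, $J:=\eta\eta^\dagger$.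 A quantum coherent algebra over $X$ is a vector subspace of $\mathscr L(l^2(X))$ containing $I$ and $J$ and closed under composition, $\bullet$, $\dagger$ and $*$. It is homogeneous if $I$ is a minimal Schur projection in it: every element $P$ with $P\bullet P=P^*=P=P\bullet I=I\bullet P$ is $0$ or $I$. A quantum association scheme $\mathbf A$ over $X$ is (formally) a homogeneous quantum coherent algebra over $X$, called its Bose--Mesner algebra. Duality: Let $\mathscr A,\mathscr B$ be quantum coherent algebras over finite quantum spaces $X,Y$ with $n:=\dim C(X)=\dim C(Y)$. $\mathscr B$ is dual to $\mathscr A$ if there is a vector space isomorphism $\Psi\colon\mathscr A\to\mathscr B$ such that for all $x,y\in\mathscr A$: $\Psi(xy)=\Psi(x)\bullet\Psi(y)$, $n\Psi(x\bullet y)=\Psi(x)\Psi(y)$, $\Psi(x^\dagger)=\Psi(x)^*$, $\Psi(x^* )=\Psi(x)^\dagger$. A quantum association scheme is dual to another one if its Bose--Mesner algebra is dual to that of the other. A finite quantum group $\Gamma$ is given by a finite-dimensional Hopf $*$-algebra $C(\Gamma)$ (comultiplication $\Delta$ and counit $\epsilon$ are $*$-homomorphisms, antipode $S$). Its Haar functional (positive left-invariant functional) $\psi$ is normalized so that it makes $C(\Gamma)$ a finite quantum space, i.e. so that $(a,b)\mapsto\psi(ab)$ is non-degenerate, $\psi(ab)=\psi(ba)$ and $mm^\dagger=\mathrm{id}$, with $\dagger$ the adjoint with respect to $\langle a,b\rangle=\psi(a^*b)$; $l^2(\Gamma)$ is the associated Hilbert space. For $x,y\in l^2(\Gamma)$: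 $x\bullet y:=m(x\otimes y)$, $x*y:=\Delta^\dagger(x\otimes y)$, $x^*$ is the involution of $C(\Gamma)$, $x^\star:=S(x^* )$. The passive dual of $C(\Gamma)$ is the Hopf $*$-algebra on the same vector space with multiplication $\Delta^\dagger$, unit $\epsilon^\dagger$, comultiplication $m^\dagger$, counit $\eta^\dagger$, antipode $S$ and involution $\star$. A finite quantum group $\hat\Gamma$ is dual to $\Gamma$ if $C(\hat\Gamma)$ is isomorphic as a Hopf $*$-algebra to the passive dual of $C(\Gamma)$; the isomorphism is denoted $\Phi\colon l^2(\Gamma)\to l^2(\hat\Gamma)$ and called the Fourier transform. The notation $\bullet,*,{}^*,{}^\star$ is used for $\hat\Gamma$ in the same way, with its own structure maps and inner product. For $x\in l^2(\Gamma)$ (and similarly for $\hat\Gamma$), $A_x\in\mathscr L(l^2(\Gamma))$ is $A_xy:=x*y$. A quantum Schur ring over $\Gamma$ is a vector subspace $S\subseteq l^2(\Gamma)$ closed under $\bullet,*,{}^*,{}^\star$ and containing $\eta$ and $\epsilon^\dagger$. A quantum translation association scheme over $\Gamma$ is a quantum association scheme whose Bose--Mesner algebra is a quantum coherent subalgebra of $\{A_x\mid x\in l^2(\Gamma)\}$; these are exactly those of the form $\{A_x\mid x\in S\}$ with $S$ a quantum Schur ring. *)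

(* Defs.v *)
From HB Require Import structures.
From mathcomp Require Import all_boot all_order all_algebra all_field.
From mathcomp Require Import complex.
From mathcomp Require Import boolp classical_sets reals.

Set Implicit Arguments.
Unset Strict Implicit.
Unset Printing Implicit Defensive.

Import Order.TTheory GRing.Theory Num.Theory.

Local Open Scope ring_scope.

Definition bas (K : fieldType) (V : vectType K) (i : 'I_(\dim {:V})) : V :=
  (vbasis {:V})`_i.

(* V (x) W is modelled by coordinate matrices in the bases [vbasis]. *)
Definition tensor (K : fieldType) (V W : vectType K) : vectType K :=
  'M[K]_(\dim {:V}, \dim {:W}).

Definition tens (K : fieldType) (V W : vectType K) (v : V) (w : W) :
    tensor V W :=
  \matrix_(i, j) (coord (vbasis {:V}) i v * coord (vbasis {:W}) j w).

(* The linear map on V (x) W induced by a bilinear map f; in Sweedler notation,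
   [tlift f T] is f(T_(1), T_(2)). See [tlift_tens] below. *)
Definition tlift (K : fieldType) (V W U : vectType K) (f : V -> W -> U)
    (T : tensor V W) : U :=
  \sum_i \sum_j (T : 'M[K]_(_, _)) i j *: f (bas i) (bas j).

Lemma tlift_is_linear (K : fieldType) (V W U : vectType K) (f : V -> W -> U) :
  linear (tlift f).
Proof.
move=> a S T; rewrite /tlift scaler_sumr -big_split /=; apply: eq_bigr => i _.
rewrite scaler_sumr -big_split /=; apply: eq_bigr => j _.
by rewrite !mxE scalerDl scalerA.
Qed.

HB.instance Definition _ (K : fieldType) (V W U : vectType K)
    (f : V -> W -> U) :=
  GRing.isLinear.Build K (tensor V W) U _ (tlift f) (tlift_is_linear f).

Lemma tlift_tens (K : fieldType) (V W U : vectType K) (f : V -> W -> U) :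
  (forall w, linear (f^~ w)) -> (forall v, linear (f v)) ->
  forall v w, tlift f (tens v w) = f v w.
Proof.
move=> fl fr v w.
pose fL w := HB.pack_for {linear V -> U} (f^~ w)
  (GRing.isLinear.Build K V U _ (f^~ w) (fl w)).
pose fR v := HB.pack_for {linear W -> U} (f v)
  (GRing.isLinear.Build K W U _ (f v) (fr v)).
rewrite [in RHS](coord_vbasis (memvf v)).
rewrite -[RHS]/(fL w _) linear_sum; apply: eq_bigr => i _.
rewrite linearZ /= [in RHS](coord_vbasis (memvf w)).
rewrite -[f _ _]/(fR _ _) linear_sum scaler_sumr; apply: eq_bigr => j _.
by rewrite linearZ /= mxE scalerA.
Qed.

Definition tmap (K : fieldType) (V W V' W' : vectType K)
    (f : 'Hom(V, V')) (g : 'Hom(W, W')) : 'Hom(tensor V W, tensor V' W') :=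
  linfun (tlift (fun v w => tens (f v) (g w))).

Definition tassoc (K : fieldType) (U V W : vectType K) :
    'Hom(tensor (tensor U V) W, tensor U (tensor V W)) :=
  linfun (tlift (fun t w => tlift (fun u v => tens u (tens v w)) t)).

Definition ipC (C : numClosedFieldType) (a b : C^o) : C := (a : C)^* * b.

Definition ip_tens (C : numClosedFieldType) (V W : vectType C)
    (ipV : V -> V -> C) (ipW : W -> W -> C) (S T : tensor V W) : C :=
  \sum_i \sum_j \sum_k \sum_l
    ((S : 'M[C]_(_, _)) i j)^* * (T : 'M[C]_(_, _)) k l
    * (ipV (bas i) (bas k) * ipW (bas j) (bas l)).

(* Inner products are antilinear on the left. [adjoint ipV ipW f] is the unique
   g such that <f x, y> = <x, g y>; it exists whenever [ipV] and [ipW] are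
   positive definite hermitian. *)
Definition adjoint (C : numClosedFieldType) (V W : vectType C)
    (ipV : V -> V -> C) (ipW : W -> W -> C) (f : 'Hom(V, W)) : 'Hom(W, V) :=
  xget 0 [set g : 'Hom(W, V) | forall x y, ipW (f x) y = ipV x (g y)]%classic.

Record star_alg (C : numClosedFieldType) := StarAlg {
  sa_alg :> falgType C;
  star : sa_alg -> sa_alg;
  star_antilinear : forall (c : C) a b,
    star (c *: a + b) = c^* *: star a + star b;
  starM : forall a b, star (a * b) = star b * star a;
  starK : involutive star }.

Definition mult (C : numClosedFieldType) (A : falgType C) :
    'Hom(tensor A A, A) :=
  linfun (tlift (fun a b : A => a * b)).

Definition unit_map (C : numClosedFieldType) (A : falgType C) : 'Hom(C^o, A) :=
  linfun (fun c : C^o => (c : C) *: (1 : A)).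

Definition ip_of (C : numClosedFieldType) (A : star_alg C) (f : 'Hom(A, C^o))
    (a b : A) : C :=
  f (star a * b).

Record fqspace (C : numClosedFieldType) := FQSpace {
  fqs_alg :> star_alg C;
  psi : 'Hom(fqs_alg, C^o);
  psi_ge0 : forall a, 0 <= (psi (star a * a) : C);
  psi_nondeg : forall a, (forall b, psi (a * b) = 0) -> a = 0;
  psi_tracial : forall a b, psi (a * b) = psi (b * a);
  mult_coisometry :
    (mult fqs_alg
       \o adjoint (ip_tens (ip_of psi) (ip_of psi)) (ip_of psi) (mult fqs_alg)
     = \1)%VF }.

Section QuantumSpace.
Context (C : numClosedFieldType) (X : fqspace C).

Definition ip : X -> X -> C := ip_of (psi X).
Definition ip2 : tensor X X -> tensor X X -> C := ip_tens ip ip.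

Definition mult_adj : 'Hom(X, tensor X X) := adjoint ip2 ip (mult X).
Definition unit_adj : 'Hom(X, C^o) := adjoint (@ipC C) ip (unit_map X).

Definition dag (A : 'End(X)) : 'End(X) := adjoint ip ip A.
Definition op_star (A : 'End(X)) : 'End(X) :=
  linfun (fun f => star (A (star f))).
Definition schur (A B : 'End(X)) : 'End(X) :=
  (mult X \o tmap A B \o mult_adj)%VF.
Definition op_J : 'End(X) := (unit_map X \o unit_adj)%VF.

End QuantumSpace.

Record coherent_algebra (C : numClosedFieldType) (X : fqspace C)
    (L : {vspace 'End(X)}) : Prop := CoherentAlgebra {
  coherent_I : \1%VF \in L;
  coherent_J : op_J X \in L;
  coherent_comp : {in L &, forall A B, (A \o B)%VF \in L};
  coherent_schur : {in L &, forall A B, schur A B \in L};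
  coherent_dag : {in L, forall A, dag A \in L};
  coherent_star : {in L, forall A, op_star A \in L} }.

Definition homogeneous (C : numClosedFieldType) (X : fqspace C)
    (L : {vspace 'End(X)}) : Prop :=
  {in L, forall P, schur P P = P -> op_star P = P ->
    schur P \1%VF = P -> schur \1%VF P = P -> P = 0 \/ P = \1%VF}.

Record qassoc_scheme (C : numClosedFieldType) (X : fqspace C) := QAssocScheme {
  bose_mesner : {vspace 'End(X)};
  bm_coherent : coherent_algebra bose_mesner;
  bm_homogeneous : homogeneous bose_mesner }.

(* [dual_algebra L M]: M is dual to L. The isomorphism from L to M is the
   restriction to L of a linear map Psi on the ambient operator space. *)
Definition dual_algebra (C : numClosedFieldType) (X Y : fqspace C)
    (L : {vspace 'End(X)}) (M : {vspace 'End(Y)}) : Prop :=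
  \dim {:X} = \dim {:Y} /\
  exists Psi : 'Hom('End(X), 'End(Y)),
    [/\ (Psi @: L)%VS = M, {in L &, injective Psi},
        {in L &, forall A B,
           Psi (A \o B)%VF = schur (Psi A) (Psi B) /\
           (\dim {:X})%:R *: Psi (schur A B) = (Psi A \o Psi B)%VF}
      & {in L, forall A,
           Psi (dag A) = op_star (Psi A) /\ Psi (op_star A) = dag (Psi A)}].

(* [dual_scheme a b]: b is dual to a. *)
Definition dual_scheme (C : numClosedFieldType) (X Y : fqspace C)
    (a : qassoc_scheme X) (b : qassoc_scheme Y) : Prop :=
  dual_algebra (bose_mesner a) (bose_mesner b).

Definition tens_mul (C : numClosedFieldType) (A : falgType C)
    (S T : tensor A A) : tensor A A :=
  tlift (fun a b => tlift (fun c d => tens (a * c) (b * d)) T) S.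

Definition tens_star (C : numClosedFieldType) (A : star_alg C)
    (T : tensor A A) : tensor A A :=
  \sum_i \sum_j
    ((T : 'M[C]_(_, _)) i j)^* *: tens (star (bas i)) (star (bas j)).

Record is_hopf_star (C : numClosedFieldType) (A : star_alg C)
    (Delta : 'Hom(A, tensor A A)) (eps : 'Hom(A, C^o)) (S : 'End(A)) : Prop :=
  IsHopfStar {
  comulM : forall a b, Delta (a * b) = tens_mul (Delta a) (Delta b);
  comul1 : Delta 1 = tens 1 1;
  comul_star : forall a, Delta (star a) = tens_star (Delta a);
  counitM : forall a b, eps (a * b) = (eps a : C) * (eps b : C);
  counit1 : eps 1 = (1 : C);
  counit_star : forall a, eps (star a) = (eps a : C)^*;
  comulA : (tassoc A A A \o tmap Delta \1 \o Delta
            = tmap \1 Delta \o Delta)%VF;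
  comul_counitl : forall a, tlift (fun b c => (eps b : C) *: c) (Delta a) = a;
  comul_counitr : forall a, tlift (fun b c => (eps c : C) *: b) (Delta a) = a;
  antipodel : (mult A \o tmap S \1 \o Delta = unit_map A \o eps)%VF;
  antipoder : (mult A \o tmap \1 S \o Delta = unit_map A \o eps)%VF }.

(* The functional [psi] of the underlying quantum space is the normalized Haar
   functional: [haar_invariant] says (id (x) psi) Delta = psi(_) 1. *)
Record fqgroup (C : numClosedFieldType) := FQGroup {
  fqg_space :> fqspace C;
  comul : 'Hom(fqg_space, tensor fqg_space fqg_space);
  counit : 'Hom(fqg_space, C^o);
  antipode : 'End(fqg_space);
  fqg_hopf : is_hopf_star comul counit antipode;
  haar_invariant : forall a : fqg_space,
    tlift (fun b c : fqg_space => (psi fqg_space c : C) *: b) (comul a)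
    = (psi fqg_space a : C) *: 1 }.

Section QuantumGroup.
Context (C : numClosedFieldType) (G : fqgroup C).

Definition comul_adj : 'Hom(tensor G G, G) :=
  adjoint (@ip C G) (@ip2 C G) (comul G).
Definition counit_adj : 'Hom(C^o, G) := adjoint (@ip C G) (@ipC C) (counit G).

Definition conv (x y : G) : G := comul_adj (tens x y).
Definition conv_star (x : G) : G := antipode G (star x).

Definition conv_op (x : G) : 'End(G) := linfun (conv x).

Record qschur_ring (S : {vspace G}) : Prop := QSchurRing {
  qsr_unit : (1 : G) \in S;
  qsr_counit : counit_adj (1 : C) \in S;
  qsr_mul : {in S &, forall x y, x * y \in S};
  qsr_conv : {in S &, forall x y, conv x y \in S};
  qsr_star : {in S, forall x, star x \in S};
  qsr_conv_star : {in S, forall x, conv_star x \in S} }.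

Definition translation_scheme (a : qassoc_scheme G) : Prop :=
  {in bose_mesner a, forall A, exists x : G, A = conv_op x}.

End QuantumGroup.

Record hopf_data (C : numClosedFieldType) (V : vectType C) := HopfData {
  hd_mult : 'Hom(tensor V V, V);
  hd_unit : 'Hom(C^o, V);
  hd_comul : 'Hom(V, tensor V V);
  hd_counit : 'Hom(V, C^o);
  hd_antipode : 'End(V);
  hd_star : V -> V }.

Definition hopf_of (C : numClosedFieldType) (G : fqgroup C) : hopf_data G :=
  HopfData (mult G) (unit_map G) (comul G) (counit G) (antipode G)
    (@star C G).

Definition passive_dual (C : numClosedFieldType) (G : fqgroup C) :
    hopf_data G :=
  HopfData (comul_adj G) (counit_adj G) (mult_adj G) (unit_adj G) (antipode G)
    (@conv_star C G).

Record hopf_iso (C : numClosedFieldType) (V W : vectType C)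
    (H : hopf_data V) (K : hopf_data W) (Phi : 'Hom(V, W)) : Prop := HopfIso {
  iso_bij : bijective Phi;
  iso_mult : (Phi \o hd_mult H = hd_mult K \o tmap Phi Phi)%VF;
  iso_unit : (Phi \o hd_unit H = hd_unit K)%VF;
  iso_comul : (tmap Phi Phi \o hd_comul H = hd_comul K \o Phi)%VF;
  iso_counit : (hd_counit H = hd_counit K \o Phi)%VF;
  iso_antipode : (Phi \o hd_antipode H = hd_antipode K \o Phi)%VF;
  iso_star : forall x, Phi (hd_star H x) = hd_star K (Phi x) }.

Definition fourier_transform (C : numClosedFieldType) (G Gh : fqgroup C)
    (Phi : 'Hom(G, Gh)) : Prop :=
  hopf_iso (passive_dual G) (hopf_of Gh) Phi.

(* Main.v *)
Require Import Defs.
From HB Require Import structures.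
From mathcomp Require Import all_boot all_order all_algebra all_field.
From mathcomp Require Import complex ring.
From mathcomp Require Import boolp classical_sets reals.

Set Implicit Arguments.
Unset Strict Implicit.
Unset Printing Implicit Defensive.

Import Order.TTheory GRing.Theory Num.Theory.

Local Open Scope ring_scope.

(** Write A_x for [conv_op x], L_x for left multiplication by x, n for the
dimension, and t for [hopf_integral G], the unit of the convolution product,
characterised by ψ(x t) = ε(x).

The theorem holds because the Fourier transform Phi is a unitary up to the
factor sqrt n ([ip_fourier]) that exchanges the two products:
   Phi (x ∗ y) = Phi x · Phi y      (part of the definition of Phi),
   Phi x ∗ Phi y = n Phi (x · y)    ([conv_fourier]).
The second formula is the adjoint of the compatibility of Phi with the
coproducts, the factor n coming from the failure of Phi to be an isometry.
So A_x is unitarily conjugate to L_(Phi x) and A_(Phi x) to n L_x.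
Left multiplications satisfy L_x L_y = L_(x y) and have adjoint L_(x^* ), and
this gives the composition and the adjoint of convolution operators on both
sides.  The operation x ↦ A^* is easier: comultiplication is a *-homomorphism,
hence (A_x)^* = A_(x^* ) over every finite quantum group ([op_star_conv]).

For Schur products one needs A_x • A_y = A_(x y), both over G and over its dual.
In Sweedler notation, traciality of ψ and multiplicativity of Δ give
   Σ (x z_1) ∗ (y z_2) = (x ∗ y) z     ([conv_mul_comul]).
The Fourier transform turns this identity over one of the two quantum groups
into the wanted one over the other ([schur_conv_op], [schur_conv_op_fourier]).
The map A_x ↦ A_(Phi x) therefore satisfies all the conditions of a duality.

The image is homogeneous whatever S is: A_(Phi x) • I = ψ(x) I, since
x ∗ 1 = ψ(x) 1 by invariance of ψ, so the only Schur idempotents below I are the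
scalars 0 and 1.

It remains to see why Phi is a scaled unitary.  The Haar functional of the dual,
composed with Phi, is invariant for the coproduct m† of the passive dual;
applying ε to the invariance formula shows that it is a multiple of ε; at t it is
the Haar functional of the dual at 1, equal to n ([psi_fourier], [psi1]).  Hence
<Phi x, Phi y> = n ε(S(x^* ) ∗ y), and it remains to compute
ε(x ∗ y) = ψ(S(y) x) together with S S = id.  Both follow from the strong
invariance of the Haar functional ([strong_invariance]) at the integral t. *)

(** * Tensors and bilinear maps *)

Lemma linfunE (K : fieldType) (V W : vectType K) (f : V -> W) :
  linear f -> linfun f =1 f.
Proof.
move=> lf v; pose F := HB.pack_for {linear V -> W} f
  (GRing.isLinear.Build K V W _ f lf).
by rewrite -[f]/(F : V -> W) lfunE.
Qed.

Lemma linear_scale (K : fieldType) (V W : vectType K) (f : V -> W) :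
  linear f -> forall c v, f (c *: v) = c *: f v.
Proof. by move=> lf c v; rewrite -!(linfunE lf) linearZ. Qed.

Section Tensors.
Variable K : fieldType.
Implicit Types U V W : vectType K.

Lemma tens_linl V W (w : W) : linear (fun v : V => tens v w).
Proof. by move=> c x y; apply/matrixP=> i j; rewrite !mxE linearP mulrDl mulrA. Qed.

Lemma tens_linr V W (v : V) : linear (fun w : W => tens v w).
Proof.
by move=> c x y; apply/matrixP=> i j; rewrite !mxE linearP mulrDr mulrCA.
Qed.

Lemma coord_bas V (i j : 'I_(\dim {:V})) :
  coord (vbasis {:V}) i (bas j) = (i == j)%:R.
Proof. by rewrite /bas (coord_free _ _ (basis_free (vbasisP _))) eq_sym. Qed.

Lemma tens_bas V W (i : 'I_(\dim {:V})) (j : 'I_(\dim {:W})) :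
  tens (bas i : V) (bas j : W) = delta_mx i j :> 'M[K]_(_, _).
Proof.
by apply/matrixP=> k l; rewrite !mxE !coord_bas -natrM mulnb.
Qed.

Lemma tlift_id V W (T : tensor V W) : tlift (@tens K V W) T = T.
Proof.
rewrite [RHS]matrix_sum_delta; apply: eq_bigr => i _; apply: eq_bigr => j _.
by rewrite tens_bas.
Qed.

Lemma eq_tlift V W U (f g : V -> W -> U) (T : tensor V W) :
  (forall v w, f v w = g v w) -> tlift f T = tlift g T.
Proof.
by move=> fg; apply: eq_bigr => i _; apply: eq_bigr => j _; rewrite fg.
Qed.

Lemma linear_tlift V W U U' (g : {linear U -> U'}) (f : V -> W -> U)
  (T : tensor V W) : g (tlift f T) = tlift (fun v w => g (f v w)) T.
Proof.
rewrite linear_sum; apply: eq_bigr => i _; rewrite linear_sum.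
by apply: eq_bigr => j _; rewrite linearZ.
Qed.

Lemma linear_tensE V W U (g : {linear tensor V W -> U}) (T : tensor V W) :
  g T = tlift (fun v w => g (tens v w)) T.
Proof. by rewrite -linear_tlift tlift_id. Qed.

(** Bilinear families depending linearly on a parameter: this is how linearity of
nested Sweedler sums is checked. *)
Lemma tlift_combine V W U (c : K) (f g : V -> W -> U) (T : tensor V W) :
  tlift (fun v w => c *: f v w + g v w) T = c *: tlift f T + tlift g T.
Proof.
rewrite /tlift scaler_sumr -big_split; apply: eq_bigr => i _ /=.
rewrite scaler_sumr -big_split; apply: eq_bigr => j _ /=.
by rewrite scalerDr !scalerA mulrC.
Qed.

Lemma tmap_tens V W V' W' (f : 'Hom(V, V')) (g : 'Hom(W, W')) v w :
  tmap f g (tens v w) = tens (f v) (g w).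
Proof.
rewrite lfunE /= tlift_tens // => [b|a] c x y; rewrite linearP.
  exact: tens_linl.
exact: tens_linr.
Qed.

Lemma tlift_tmap V W V' W' U (f : 'Hom(V, V')) (g : 'Hom(W, W'))
  (h : V' -> W' -> U) (T : tensor V W) :
  (forall w, linear (h^~ w)) -> (forall v, linear (h v)) ->
  tlift h (tmap f g T) = tlift (fun v w => h (f v) (g w)) T.
Proof.
move=> hl hr; rewrite lfunE /= linear_tlift.
by apply: eq_tlift => v w; rewrite /= tlift_tens.
Qed.

Lemma scaler_tlift V W U (c : K) (f : V -> W -> U) (T : tensor V W) :
  c *: tlift f T = tlift (fun v w => c *: f v w) T.
Proof.
rewrite scaler_sumr; apply: eq_bigr => i _; rewrite scaler_sumr.
by apply: eq_bigr => j _; rewrite !scalerA mulrC.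
Qed.

Lemma mulr_tlift V W (A : falgType K) (a : A) (f : V -> W -> A)
  (T : tensor V W) : a * tlift f T = tlift (fun v w => a * f v w) T.
Proof.
rewrite mulr_sumr; apply: eq_bigr => i _; rewrite mulr_sumr.
by apply: eq_bigr => j _; rewrite scalerAr.
Qed.

Lemma mull_tlift V W (A : falgType K) (a : A) (f : V -> W -> A)
  (T : tensor V W) : tlift f T * a = tlift (fun v w => f v w * a) T.
Proof.
rewrite mulr_suml; apply: eq_bigr => i _; rewrite mulr_suml.
by apply: eq_bigr => j _; rewrite scalerAl.
Qed.

End Tensors.

(** * Hermitian forms and adjoints *)

Section HermitianForms.
Variable C : numClosedFieldType.
Implicit Types V W : vectType C.

(** Nondegeneracy is the form of definiteness on which the existence and uniqueness
of adjoints rest. *)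
Record hermitian_form V (h : V -> V -> C) : Prop := HermitianForm {
  hformDr : forall x c y z, h x (c *: y + z) = c * h x y + h x z;
  hformC : forall x y, (h x y)^* = h y x;
  hform_nondeg : forall y, (forall x, h x y = 0) -> y = 0 }.

Lemma hform_linear V (h : V -> V -> C) (hh : hermitian_form h) x :
  linear (h x : V -> C^o).
Proof. by move=> c y z; rewrite hformDr. Qed.

Lemma hformDl V (h : V -> V -> C) (hh : hermitian_form h) x c y z :
  h (c *: y + z) x = c^* * h y x + h z x.
Proof. by rewrite -hformC // hformDr // rmorphD rmorphM /= !hformC. Qed.

Lemma hformZr V (h : V -> V -> C) (hh : hermitian_form h) x c y :
  h x (c *: y) = c * h x y.
Proof. exact: (linear_scale (hform_linear hh x)). Qed.

Lemma hformZl V (h : V -> V -> C) (hh : hermitian_form h) x c y :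
  h (c *: y) x = c^* * h y x.
Proof. by rewrite -hformC // hformZr // rmorphM /= hformC. Qed.

Lemma hform_suml V (h : V -> V -> C) (hh : hermitian_form h) x n
  (c : 'I_n -> C) (v : 'I_n -> V) :
  h (\sum_i c i *: v i) x = \sum_i (c i)^* * h (v i) x.
Proof.
elim: n c v => [|n IH] c v.
  by rewrite !big_ord0 -(scale0r 0) hformZl // rmorph0 mul0r.
by rewrite !big_ord_recl hformDl // IH.
Qed.

Lemma hform_sumr V (h : V -> V -> C) (hh : hermitian_form h) x n
  (c : 'I_n -> C) (v : 'I_n -> V) :
  h x (\sum_i c i *: v i) = \sum_i c i * h x (v i).
Proof.
rewrite -hformC // hform_suml // (rmorph_sum (@Num.conj C)).
apply: eq_bigr => i _.
by rewrite rmorphM /= conjCK hformC.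
Qed.

Lemma hform_eq V (h : V -> V -> C) (hh : hermitian_form h) y z :
  (forall x, h x y = h x z) -> y = z.
Proof.
move=> yz; apply/eqP; rewrite -subr_eq0; apply/eqP/(hform_nondeg hh) => x.
by rewrite addrC -scaleN1r hformDr // yz mulN1r addNr.
Qed.

Lemma bas_inj V (c d : 'I_(\dim {:V}) -> C) :
  \sum_i c i *: (bas i : V) = \sum_i d i *: bas i -> c =1 d.
Proof.
move=> cd i; have /(congr1 (coord (vbasis {:V}) i)) := cd.
have E (e : 'I_(\dim {:V}) -> C) :
    coord (vbasis {:V}) i (\sum_j e j *: (bas j : V)) = e i.
  rewrite linear_sum (bigD1 i) //= linearZ /= coord_bas eqxx mulr1 big1 ?addr0 //.
  by move=> j ji; rewrite linearZ /= coord_bas eq_sym (negPf ji) mulr0.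
by rewrite !E.
Qed.

(** A nondegenerate form identifies V with its antilinear functionals: the map
sending y to the element with coordinates <e_i, y> is injective, hence bijective
by dimension. *)
Lemma hform_adjoint V W (hV : V -> V -> C) (hW : W -> W -> C) :
  hermitian_form hV -> hermitian_form hW ->
  forall (f : 'Hom(V, W)) x y, hW (f x) y = hV x (adjoint hV hW f y).
Proof.
move=> hhV hhW f; suff: exists g : 'Hom(W, V),
    forall x y, hW (f x) y = hV x (g y) by move=> /(xgetPex 0).
pose G (y : V) : V := \sum_i hV (bas i) y *: bas i.
have Glin : linear G.
  move=> c y z; rewrite scaler_sumr -big_split; apply: eq_bigr => i _ /=.
  by rewrite hformDr // scalerDl scalerA.
pose H (y : W) : V := \sum_i hW (f (bas i)) y *: bas i.
have Hlin : linear H.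
  move=> c y z; rewrite scaler_sumr -big_split; apply: eq_bigr => i _ /=.
  by rewrite hformDr // scalerDl scalerA.
have G_inj : lker (linfun G) == 0%VS.
  apply/lker0P => y z; rewrite !linfunE // => /bas_inj yz.
  apply: (hform_eq hhV) => x; rewrite (coord_vbasis (memvf x)) !hform_suml //.
  by apply: eq_bigr => i _; congr (_ * _); apply: yz.
exists ((linfun G)^-1 \o linfun H)%VF => x y.
set gy := ((_ \o _)%VF y).
have: G gy = H y.
  by rewrite -[LHS](linfunE Glin) /gy comp_lfunE lker0_lfunVK // linfunE.
move=> /bas_inj E; rewrite (coord_vbasis (memvf x)) linear_sum /=.
under eq_bigr do rewrite linearZ /=.
by rewrite !hform_suml //; apply: eq_bigr => i _; rewrite -E.
Qed.

Lemma adjoint_eq V W (hV : V -> V -> C) (hW : W -> W -> C)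
  (f : 'Hom(V, W)) (g : 'Hom(W, V)) :
  hermitian_form hV -> hermitian_form hW ->
  (forall x y, hW (f x) y = hV x (g y)) -> adjoint hV hW f = g.
Proof.
move=> hhV hhW fg; apply/lfunP => y; apply: (hform_eq hhV) => x.
by rewrite -hform_adjoint.
Qed.

Lemma hform_adjointC V W (hV : V -> V -> C) (hW : W -> W -> C) :
  hermitian_form hV -> hermitian_form hW ->
  forall (f : 'Hom(V, W)) x y, hV (adjoint hV hW f y) x = hW y (f x).
Proof.
by move=> hhV hhW f x y; rewrite -hformC // -hform_adjoint // hformC.
Qed.

Lemma ipC_hform : hermitian_form (@ipC C).
Proof.
split=> [x c y z|x y|y /(_ 1)]; rewrite /ipC.
- by rewrite mulrDr mulrCA.
- by rewrite rmorphM /= conjCK mulrC.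
- by rewrite rmorph1 mul1r.
Qed.

Lemma ip_tensl V W (hV : V -> V -> C) (hW : W -> W -> C) v w T :
  hermitian_form hV -> hermitian_form hW ->
  ip_tens hV hW (tens v w) T
  = tlift (fun x y => hV v x * hW w y : C^o) T.
Proof.
move=> hhV hhW; rewrite /ip_tens pair_big /=.
under eq_bigr do rewrite pair_big /=.
rewrite exchange_big [RHS]pair_big; apply: eq_bigr => -[k l] _ /=.
rewrite {2}(coord_vbasis (memvf v)) {2}(coord_vbasis (memvf w)) !hform_suml //.
rewrite mulr_suml scaler_sumr.
under [RHS]eq_bigr do rewrite mulr_sumr scaler_sumr.
rewrite [RHS]pair_big; apply: eq_bigr => -[i j] _ /=.
by rewrite mxE rmorphM -[_ *: _]/(_ * _) [_ * _ k l]mulrC -[LHS]mulrA mulrACA.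
Qed.

(** Nondegeneracy is obtained one tensor factor at a time: pairing with v ⊗ w for
all v, and then for all w. *)
Lemma ip_tens_hform V W (hV : V -> V -> C) (hW : W -> W -> C) :
  hermitian_form hV -> hermitian_form hW -> hermitian_form (ip_tens hV hW).
Proof.
move=> hhV hhW; split=> [S c T U|S T|T T0].
- rewrite /ip_tens mulr_sumr -big_split; apply: eq_bigr => i _ /=.
  rewrite mulr_sumr -big_split; apply: eq_bigr => j _ /=.
  rewrite mulr_sumr -big_split; apply: eq_bigr => k _ /=.
  rewrite mulr_sumr -big_split; apply: eq_bigr => l _ /=.
  by rewrite !mxE mulrDr mulrDl -!mulrA; congr (_ + _); rewrite mulrCA.
- rewrite /ip_tens (rmorph_sum (@Num.conj C)).
  transitivity (\sum_i \sum_j \sum_k \sum_l (T k l)^* * (S : 'M__) i j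
                  * (hV (bas k) (bas i) * hW (bas l) (bas j))).
    apply: eq_bigr => i _; rewrite (rmorph_sum (@Num.conj C)); apply: eq_bigr => j _.
    rewrite (rmorph_sum (@Num.conj C)); apply: eq_bigr => k _.
    rewrite (rmorph_sum (@Num.conj C)); apply: eq_bigr => l _.
    by rewrite !rmorphM /= conjCK !hformC // [_ * (T k l)^*]mulrC.
  rewrite pair_big /=.
  under eq_bigr do rewrite pair_big /=.
  rewrite exchange_big /= [RHS]pair_big /=.
  by apply: eq_bigr => p _; rewrite pair_big.
- have E v w : \sum_k (\sum_l (T : 'M__) k l * hW w (bas l)) * hV v (bas k) = 0.
    rewrite -[RHS](T0 (tens v w)) ip_tensl // /tlift; apply: eq_bigr => k _.
    rewrite mulr_suml; apply: eq_bigr => l _.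
    by rewrite -mulrA [hW _ _ * _]mulrC.
  apply/matrixP => k l; rewrite mxE.
  have F w : \sum_l (T : 'M__) k l * hW w (bas l) = 0.
    have /bas_inj/(_ k) // :
      \sum_k (\sum_l (T : 'M__) k l * hW w (bas l)) *: (bas k : V) = \sum_k 0 *: bas k.
    rewrite [RHS]big1 => [|i _]; last by rewrite scale0r.
    by apply: (hform_nondeg hhV) => v; rewrite hform_sumr.
  have /bas_inj/(_ l) // : \sum_l (T : 'M__) k l *: (bas l : W)
       = \sum_l 0 *: bas l.
  rewrite [RHS]big1 => [|i _]; last by rewrite scale0r.
  by apply: (hform_nondeg hhW) => w; rewrite hform_sumr.
Qed.

End HermitianForms.

(** * Finite quantum spaces *)

Section QuantumSpaces.
Variables (C : numClosedFieldType) (X : fqspace C).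
Implicit Types a b x y z : X.

Local Notation ψ := (psi X).

Lemma star1 : star (1 : X) = 1.
Proof. by rewrite -[LHS]mulr1 -{2}[1]starK -starM mulr1 starK. Qed.

Lemma star_lin (c : C) a b : star (c *: a + b) = c^* *: star a + star b.
Proof. exact: star_antilinear. Qed.

Lemma starZ (c : C) a : star (c *: a) = c^* *: star a.
Proof.
have star0 : star (0 : X) = 0.
  have /eqP := star_lin 1 0 0.
  by rewrite conjC1 !scale1r add0r -subr_eq subrr eq_sym => /eqP.
by rewrite -[c *: a]addr0 star_lin star0 addr0.
Qed.

(** Polarization of positivity: ψ(a^* a) is real at c^* a + 1 and at c^* a, so
c ψ(a^* ) + c^* ψ(a) is real for every scalar c. *)
Lemma psi_star a : (ψ (star a) : C) = (ψ a : C)^*.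
Proof.
have real (c : C) : c * (ψ (star a) : C) + c^* * (ψ a : C) \is Num.real.
  have -> : c * (ψ (star a) : C) + c^* * (ψ a : C)
      = (ψ (star (c^* *: a + 1) * (c^* *: a + 1)) : C)
        - (ψ (star (c^* *: a) * (c^* *: a)) : C) - (ψ (star 1 * 1) : C).
    rewrite star_lin star1 starZ conjCK mulrDl mul1r mulrDr !mulr1.
    rewrite !linearD !linearZ /=.
    have cancel (A B u v : C) : u + v = A + u + (v + B) - A - B by ring.
    exact: cancel.
  by rewrite !rpredB // ger0_real //; apply: psi_ge0.
(* c = 1 and c = 'i determine the real and the imaginary part. *)
move: (ψ a : C) (ψ (star a) : C) real => p q real.
have /CrealP := real 1; rewrite conjC1 !mul1r rmorphD /= => Re_eq.
have Im_eq : p^* - q^* = q - p.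
  have /CrealP := real 'i; rewrite conjCi rmorphD !rmorphM rmorphN /= conjCi.
  move=> E; apply: (mulfI (neq0Ci C)).
  by rewrite [RHS]mulrBr -[- (_ * p)]mulNr -E; ring.
have two : 2 != 0 :> C by rewrite pnatr_eq0.
apply: (mulfI two).
have -> : 2 * q = (q + p) + (q - p) by ring.
by rewrite -Re_eq -Im_eq; ring.
Qed.

Lemma ip_hform : hermitian_form (@ip C X).
Proof.
split=> [x c y z|x y|y y0]; rewrite /ip /ip_of.
- by rewrite mulrDr -scalerAr linearP.
- by rewrite -psi_star starM starK.
- apply: psi_nondeg => b; rewrite psi_tracial.
  by have := y0 (star b); rewrite /ip /ip_of starK.
Qed.

Lemma ip2_hform : hermitian_form (@ip2 C X).
Proof. exact: ip_tens_hform ip_hform ip_hform. Qed.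

Lemma psi_inj x y : (forall z, ψ (z * x) = ψ (z * y)) -> x = y.
Proof. by move=> xy; apply: (hform_eq ip_hform) => z; apply: xy. Qed.

Lemma unit_mapE c : unit_map X c = (c : C) *: 1.
Proof. by apply: linfunE => k u v; rewrite scalerDl scalerA. Qed.

Lemma unit_adjE a : unit_adj X a = ψ a.
Proof.
have := hform_adjoint (ipC_hform C) ip_hform (unit_map X) 1 a.
by rewrite unit_mapE scale1r /ip /ip_of star1 mul1r /ipC conjC1 mul1r.
Qed.

Lemma mult_tens a b : mult X (tens a b) = a * b.
Proof.
by rewrite lfunE /= tlift_tens // => w c u v; rewrite ?mulrDl ?mulrDr
  -?scalerAl -?scalerAr.
Qed.

Lemma psi2_linl x y b : linear (fun a => ψ (x * a) * ψ (y * b) : C^o).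
Proof.
by move=> c u v; rewrite mulrDr -scalerAr linearP mulrDl -scalerAl.
Qed.

Lemma psi2_linr x y a : linear (fun b => ψ (x * a) * ψ (y * b) : C^o).
Proof.
by move=> c u v; rewrite mulrDr -scalerAr linearP mulrDr -scalerAr.
Qed.

Lemma ip2_tensl x y T :
  ip2 (tens x y) T = tlift (fun a b => ψ (star x * a) * ψ (star y * b) : C^o) T.
Proof. exact: ip_tensl ip_hform ip_hform. Qed.

(** The defining property of m† in Sweedler form: if m†(z) = z_(1) ⊗ z_(2), then
ψ(x z_(1)) ψ(y z_(2)) = ψ(y x z). *)
Lemma psi_mult_adj x y z :
  tlift (fun a b => ψ (x * a) * ψ (y * b) : C^o) (mult_adj X z)
  = ψ (y * x * z).
Proof.
rewrite -{1}[x]starK -{1}[y]starK -ip2_tensl.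
by rewrite -(hform_adjoint ip2_hform ip_hform) mult_tens /ip /ip_of starM !starK.
Qed.

(** Simple tensors span. *)
Lemma ip2_eq (S T : tensor X X) :
  (forall x y, ip2 (tens x y) S = ip2 (tens x y) T) -> S = T.
Proof.
move=> ST; apply: (hform_eq ip2_hform) => U.
rewrite -![ip2 U _](hformC ip2_hform); congr (_^*).
pose f R (V : tensor X X) : C^o := ip2 R V.
have fl R : linear (f R) by exact: (hform_linear ip2_hform).
rewrite -[ip2 S U](linfunE (fl S)) -[ip2 T U](linfunE (fl T)).
rewrite linear_tensE [RHS]linear_tensE; apply: (@eq_tlift _ _ _ C^o) => x y.
by rewrite /= !linfunE // /f -!(hformC ip2_hform (tens x y)) ST.
Qed.

Lemma mult_mult_adj z : mult X (mult_adj X z) = z.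
Proof. by have /lfunP/(_ z) := mult_coisometry X; rewrite comp_lfunE id_lfunE. Qed.

(** In a basis with Gram matrix K of (a, b) ↦ ψ(a b), the tensor m†(1) is K^-1.
Then ψ(1) = ψ(m m†(1)) is the trace of K^-1 K. *)
Lemma psi1 : (ψ (1 : X) : C) = (\dim {:X})%:R.
Proof.
pose K : 'M[C]_(\dim {:X}) := \matrix_(i, j) (ψ (bas i * bas j) : C).
pose P : 'M[C]_(\dim {:X}) := mult_adj X 1.
have Ksym : K^T = K by apply/matrixP => i j; rewrite !mxE psi_tracial.
have Kunit : K \in unitmx.
  rewrite -row_free_unit -kermx_eq0; apply/eqP/row_matrixP => r.
  rewrite row0; set v := row r _.
  have vK : v *m K = 0 by rewrite -row_mul mulmx_ker row0.
  have : \sum_i v 0 i *: (bas i : X) = \sum_i 0 *: bas i.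
    rewrite [RHS]big1 => [|i _]; last by rewrite scale0r.
    apply: psi_nondeg => b; rewrite (coord_vbasis (memvf b)) mulr_sumr.
    rewrite linear_sum big1 // => j _; rewrite -scalerAr linearZ /= mulr_suml.
    have /matrixP/(_ 0 j) := vK; rewrite !mxE linear_sum /= => E.
    have -> : \sum_i ψ (v 0 i *: bas i * (vbasis {:X})`_j) = 0 :> C^o.
      rewrite -[RHS]E; apply: eq_bigr => i _; rewrite -scalerAl linearZ /=.
      by rewrite !mxE.
    by rewrite scaler0.
  by move/bas_inj => v0; apply/rowP => i; rewrite v0 mxE.
(* [psi_mult_adj] at 1, read on the basis, says K P K = K. *)
have PK : P *m K = 1%:M.
  apply: (can_inj (mulKmx Kunit)); rewrite mulmx1 -{3}Ksym.
  apply/matrixP => i j; rewrite !mxE.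
  transitivity (ψ (bas j * bas i * 1) : C); last by rewrite mulr1.
  rewrite -psi_mult_adj; apply: eq_bigr => k _; rewrite !mxE mulr_sumr.
  apply: eq_bigr => l _; rewrite !mxE -[_ *: _]/(_ * _).
  by rewrite mulrCA (psi_tracial (bas l)).
rewrite -mxtrace1 -PK -{1}[1]mult_mult_adj lfunE /= linear_tlift.
apply: eq_bigr => i _; rewrite !mxE; apply: eq_bigr => j _.
by rewrite !mxE psi_tracial.
Qed.

Lemma schurE (A B : 'End(X)) z :
  schur A B z = tlift (fun a b => A a * B b) (mult_adj X z).
Proof.
rewrite /schur !comp_lfunE [mult _ _]lfunE /= tlift_tmap // => w c u v.
  by rewrite mulrDl scalerAl.
by rewrite mulrDr scalerAr.
Qed.

Lemma schurZr (A B : 'End(X)) (c : C) : schur A (c *: B) = c *: schur A B.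
Proof.
apply/lfunP => z; rewrite scale_lfunE !schurE scaler_tlift.
by apply: eq_tlift => a b; rewrite scale_lfunE scalerAr.
Qed.

Lemma dim_neq0 : (\dim {:X})%:R != 0 :> C.
Proof.
rewrite pnatr_eq0 dimv_eq0; apply/eqP => X0.
by have := oner_neq0 X; rewrite -memv0 -X0 memvf.
Qed.

End QuantumSpaces.

(** * Finite quantum groups *)

Section QuantumGroups.
Variables (C : numClosedFieldType) (G : fqgroup C).
Implicit Types a b w x y z : G.

Local Notation ψ := (psi G).
Local Notation Δ := (comul G).
Local Notation ε := (counit G).
Local Notation S := (antipode G).

(** Coassociativity in the form b_1 ⊗ b_2 ⊗ c = b ⊗ c_1 ⊗ c_2 under an arbitrary
trilinear map. *)
Lemma tlift_comulA (U : vectType C) (F : G -> G -> G -> U) a :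
  (forall y z, linear (fun x => F x y z)) ->
  (forall x z, linear (fun y => F x y z)) ->
  (forall x y, linear (fun z => F x y z)) ->
  tlift (fun b c => tlift (fun b1 b2 => F b1 b2 c) (Δ b)) (Δ a)
  = tlift (fun b c => tlift (fun c1 c2 => F b c1 c2) (Δ c)) (Δ a).
Proof.
move=> F1 F2 F3.
(* L applied to the two sides of [comulA] gives the two sides of the goal. *)
pose L : tensor G (tensor G G) -> U :=
  tlift (fun x (T : tensor G G) => tlift (F x) T).
have Ll (T : tensor G G) : linear (fun x => tlift (F x) T).
  move=> c u v; rewrite -tlift_combine; apply: eq_tlift => y z.
  exact: F1.
have Lr x : linear (fun T : tensor G G => tlift (F x) T).
  exact: tlift_is_linear.
have /lfunP/(_ a) := comulA (fqg_hopf G); rewrite !comp_lfunE => /(congr1 L).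
rewrite {2}/L tlift_tmap //.
under [RHS]eq_tlift do rewrite id_lfunE.
move=> <-; rewrite /L [tassoc _ _ _ _]lfunE /= linear_tlift.
rewrite tlift_tmap => [|c k u v|T k u v].
- apply: eq_tlift => b c; rewrite id_lfunE linear_tlift.
  by apply: eq_tlift => b1 b2; rewrite /= !tlift_tens.
- by rewrite !linearP.
- rewrite -linearP -tlift_combine; congr (_ _).
  by apply: eq_tlift => y z; rewrite !tens_linr.
Qed.

Lemma tlift_comulM (U : vectType C) (F : G -> G -> U) a b :
  (forall y, linear (F^~ y)) -> (forall x, linear (F x)) ->
  tlift F (Δ (a * b))
  = tlift (fun a1 a2 => tlift (fun b1 b2 => F (a1 * b1) (a2 * b2)) (Δ b)) (Δ a).
Proof.
move=> Fl Fr; rewrite (comulM (fqg_hopf G)) /tens_mul linear_tlift.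
apply: eq_tlift => a1 a2; rewrite linear_tlift.
by apply: eq_tlift => b1 b2; rewrite /= tlift_tens.
Qed.

Lemma antipodel_tlift a : tlift (fun b c => S b * c) (Δ a) = (ε a : C) *: 1.
Proof.
have /lfunP/(_ a) := antipodel (fqg_hopf G); rewrite !comp_lfunE unit_mapE.
rewrite [mult _ _]lfunE /= tlift_tmap => [<-|z c u v|z c u v].
- by apply: eq_tlift => b c; rewrite id_lfunE.
- by rewrite mulrDl -scalerAl.
- by rewrite mulrDr -scalerAr.
Qed.

(** In Sweedler notation, w_1 ψ(z w_2) = S(z_1) ψ(z_2 w).  By the antipode axiom and
coassociativity, w_1 ψ(z w_2) = S(z_1) z_2 w_1 ψ(z_3 w_2), and invariance of ψ
evaluates z_2 w_1 ψ(z_3 w_2) to ψ(z_2 w) 1. *)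
Lemma strong_invariance w z :
  tlift (fun w1 w2 => (ψ (z * w2) : C) *: w1) (Δ w)
  = tlift (fun z1 z2 => (ψ (z2 * w) : C) *: S z1) (Δ z).
Proof.
(* [H 1 z] is the left-hand side, and [tlift H] applied to [Δ b] is
   (id ⊗ ψ)Δ(b w). *)
pose H a b := tlift (fun w1 w2 => (ψ (b * w2) : C) *: (a * w1)) (Δ w).
have Hl b : linear (H^~ b).
  move=> c u v; rewrite /H -tlift_combine; apply: eq_tlift => w1 w2.
  by rewrite mulrDl scalerDr -scalerAl !scalerA mulrC.
have Hr a : linear (H a).
  move=> c u v; rewrite /H -tlift_combine; apply: eq_tlift => w1 w2.
  by rewrite mulrDl -scalerAl linearP scalerDl scalerA.
have HM a b c : H (a * b) c = a * H b c.
  by rewrite mulr_tlift; apply: eq_tlift => w1 w2 /=; rewrite -mulrA scalerAr.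
have haarH b : tlift H (Δ b) = (ψ (b * w) : C) *: 1.
  by rewrite -haar_invariant tlift_comulM // => c u v k; rewrite linearP ?scalerDl
    ?scalerDr ?scalerA // mulrC.
have -> : tlift (fun w1 w2 => (ψ (z * w2) : C) *: w1) (Δ w) = H 1 z.
  by apply: eq_tlift => w1 w2; rewrite mul1r.
have Slin c : linear (fun b => S b * c).
  by move=> k u v; rewrite linearP mulrDl -scalerAl.
(* Insert ε(z_1) 1 = S(z_1) z_2 on the left of H. *)
transitivity (tlift (fun b c => (ε b : C) *: H 1 c) (Δ z)).
  rewrite -[LHS](linfunE (Hr 1)) -{1}(comul_counitl (fqg_hopf G) z).
  rewrite linear_tlift; apply: eq_tlift => b c.
  by rewrite linearZ /= linfunE.
transitivity (tlift (fun b c => tlift (fun b1 b2 => S b1 * H b2 c) (Δ b)) (Δ z)).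
  apply: eq_tlift => b c.
  transitivity (tlift (fun b1 b2 => S b1 * b2) (Δ b) * H 1 c).
    by rewrite antipodel_tlift -scalerAl mul1r.
  rewrite mull_tlift.
  by apply: eq_tlift => b1 b2 /=; rewrite -{2}[b2]mulr1 HM mulrA.
rewrite (tlift_comulA (F := fun x y z => S x * H y z)) => [|y c|x c|x y].
- apply: eq_tlift => b c; rewrite -mulr_tlift haarH.
  by rewrite -scalerAr mulr1.
- exact: Slin.
- by move=> k u v; rewrite Hl mulrDr -scalerAr.
- by move=> k u v; rewrite Hr mulrDr -scalerAr.
Qed.

(** The unit of the convolution product.  Being the Riesz representative of ε
([psi_hopf_integral]), it is also an integral of the Hopf algebra
([hopf_integral_mul]). *)
Definition hopf_integral : G := counit_adj G (1 : C).

Local Notation t := hopf_integral.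

Lemma psi_hopf_integral x : ψ (x * t) = ε x.
Proof.
rewrite -{1}[x]starK -[ψ _]/(ip (star x) t) /t.
rewrite -(hform_adjoint (ip_hform G) (ipC_hform C)) /ipC mulr1.
by rewrite (counit_star (fqg_hopf G)) conjCK.
Qed.

Lemma hopf_integral_mul y : t * y = (ε y : C) *: t.
Proof.
apply: psi_inj => z; rewrite mulrA psi_tracial mulrA psi_hopf_integral.
by rewrite -scalerAr linearZ /= psi_hopf_integral (counitM (fqg_hopf G)).
Qed.

Lemma tlift_mult_adj_counit x :
  tlift (fun a b => (ε a : C) *: b) (mult_adj G x) = t * x.
Proof.
apply: psi_inj => y; rewrite mulrA -psi_mult_adj mulr_tlift linear_tlift.
apply: eq_tlift => a b /=.
by rewrite -scalerAr linearZ /= (psi_tracial t) psi_hopf_integral.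
Qed.

Lemma counit_hopf_integral : (ε t : C) = 1.
Proof.
(* Both sides of m m† 1 = 1 are tested with ε, a character equal to ψ(t ·). *)
have := psi_mult_adj t t (1 : G); rewrite mulr1 psi_hopf_integral => <-.
rewrite -[RHS](counit1 (fqg_hopf G)) -{2}[1]mult_mult_adj.
rewrite [mult _ _]lfunE /= linear_tlift; apply: (@eq_tlift _ _ _ C^o) => a b /=.
by rewrite (counitM (fqg_hopf G)) !(psi_tracial t) !psi_hopf_integral.
Qed.

(** Strong invariance with w the integral: ψ(z_2 t) = ε(z_2). *)
Lemma antipodeE z : S z = tlift (fun t1 t2 => (ψ (z * t2) : C) *: t1) (Δ t).
Proof.
rewrite strong_invariance -{1}(comul_counitr (fqg_hopf G) z) linear_tlift.
by apply: eq_tlift => b c; rewrite /= linearZ psi_hopf_integral.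
Qed.

(** By [antipodeE] and traciality, S(S z) = S(t_1) ψ(t_2 z), and strong invariance
at the integral on the other side returns z. *)
Lemma antipodeK z : S (S z) = z.
Proof.
rewrite (antipodeE z) linear_tlift /= -[RHS](comul_counitr (fqg_hopf G)).
transitivity (tlift (fun t1 t2 => (ψ (t2 * z) : C) *: S t1) (Δ t)).
  by apply: eq_tlift => t1 t2; rewrite linearZ psi_tracial.
rewrite -strong_invariance; apply: eq_tlift => z1 z2.
by rewrite psi_tracial psi_hopf_integral.
Qed.

Lemma conv_linl y : linear (fun x => conv x y).
Proof. by move=> c u v; rewrite /conv tens_linl linearP. Qed.

Lemma conv_linr x : linear (fun y => conv x y).
Proof. by move=> c u v; rewrite /conv tens_linr linearP. Qed.

Lemma conv_opE x y : conv_op x y = conv x y.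
Proof. exact: (linfunE (conv_linr x)). Qed.

Lemma conv_op_linear : linear (@conv_op C G).
Proof.
move=> c x x'; apply/lfunP => y.
by rewrite add_lfunE scale_lfunE !conv_opE conv_linl.
Qed.

Lemma ip_conv x y z :
  ip (conv x y) z
  = tlift (fun z1 z2 => ψ (star x * z1) * ψ (star y * z2) : C^o) (Δ z).
Proof.
rewrite -ip2_tensl /conv /comul_adj.
exact: hform_adjointC (ip_hform G) (ip2_hform G) _ _ _.
Qed.

(** Since Δ preserves the involution, the adjoint defining the convolution becomes
a bilinear pairing: ψ(z (x ∗ y)) = ψ(z_1 x) ψ(z_2 y). *)
Lemma psi_conv x y z :
  ψ (z * conv x y) = tlift (fun z1 z2 => ψ (z1 * x) * ψ (z2 * y) : C^o) (Δ z).
Proof.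
have -> : ψ (z * conv x y) = (ip (conv x y) (star z))^*.
  by rewrite hformC ?/ip ?/ip_of ?starK //; apply: ip_hform.
rewrite ip_conv (comul_star (fqg_hopf G)) /tens_star !linear_sum /=.
rewrite (rmorph_sum (@Num.conj C)); apply: eq_bigr => i _.
rewrite linear_sum (rmorph_sum (@Num.conj C)); apply: eq_bigr => j _ /=.
rewrite linearZ /= tlift_tens; [|exact: psi2_linl|exact: psi2_linr].
by rewrite !rmorphM /= conjCK -!psi_star !starM !starK.
Qed.

Lemma star_conv x y : star (conv x y) = conv (star x) (star y).
Proof.
apply: psi_inj => z; rewrite psi_conv psi_tracial -[ψ _]/(ip (conv x y) z).
by rewrite ip_conv; apply: eq_tlift => z1 z2; rewrite !(psi_tracial (star _)).
Qed.

Lemma op_star_conv x : op_star (conv_op x) = conv_op (star x).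
Proof.
apply/lfunP => y; rewrite [LHS]linfunE => [|c u v].
  by rewrite !conv_opE star_conv starK.
by rewrite star_lin linearP star_lin conjCK.
Qed.

(** This is the adjoint of the invariance of ψ. *)
Lemma conv1 x : conv x 1 = (ψ x : C) *: 1.
Proof.
apply: psi_inj => z; rewrite psi_conv -scalerAr mulr1 linearZ /=.
rewrite -[RHS]/(_ * _) mulrC.
transitivity (ψ (tlift (fun b c => (ψ c : C) *: b) (Δ z) * x)).
  rewrite mull_tlift linear_tlift.
  by apply: eq_tlift => z1 z2 /=; rewrite mulr1 -scalerAl linearZ mulrC.
by rewrite haar_invariant -scalerAl mul1r linearZ.
Qed.

(** ψ is the counit of the passive dual. *)
Lemma psi_convM x y : (ψ (conv x y) : C) = (ψ x : C) * (ψ y : C).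
Proof.
rewrite -[conv x y]mul1r psi_conv (comul1 (fqg_hopf G)).
rewrite tlift_tens ?mul1r // => b c u v.
  by rewrite mulrDl -scalerAl linearP mulrDl -scalerAl.
by rewrite mulrDl -scalerAl linearP mulrDr -scalerAr.
Qed.

Lemma counit_conv x y : ε (conv x y) = ψ (S y * x).
Proof.
rewrite -psi_hopf_integral (psi_tracial _ t) psi_conv antipodeE.
rewrite mull_tlift linear_tlift.
apply: eq_tlift => z1 z2 /=; rewrite -scalerAl linearZ mulrC.
by rewrite (psi_tracial z2).
Qed.

(** In Sweedler notation, pairing with w gives ψ(w_1 x z_1) ψ(w_2 y z_2), which by
traciality and multiplicativity of Δ is the pairing of z w with x ∗ y. *)
Lemma conv_mul_comul x y z :
  tlift (fun z1 z2 => conv (x * z1) (y * z2)) (Δ z) = conv x y * z.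
Proof.
apply: psi_inj => w; rewrite mulrA (psi_tracial _ z) mulrA psi_conv.
rewrite tlift_comulM; last 2 first.
- by move=> b c u v; rewrite mulrDl -scalerAl linearP mulrDl -scalerAl.
- by move=> b c u v; rewrite mulrDl -scalerAl linearP mulrDr -scalerAr.
rewrite mulr_tlift linear_tlift; apply: eq_tlift => z1 z2 /=.
rewrite psi_conv; apply: eq_tlift => w1 w2.
by rewrite !mulrA !(psi_tracial _ z1) !(psi_tracial _ z2) !mulrA.
Qed.

End QuantumGroups.

(** * The Fourier transform *)

Section Fourier.
Variables (C : numClosedFieldType) (G Gh : fqgroup C) (Phi : 'Hom(G, Gh)).
Hypothesis Phi_fourier : fourier_transform Phi.
Implicit Types x y z : G.

Local Notation n := ((\dim {:G})%:R : C).
Local Notation t := (hopf_integral G).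

Lemma fourier_inj : injective Phi.
Proof. exact: bij_inj (iso_bij Phi_fourier). Qed.

Lemma fourier_surj (u : Gh) : exists x, u = Phi x.
Proof. by case: (iso_bij Phi_fourier) => g _ gK; exists (g u); rewrite gK. Qed.

Lemma fourier_dim : \dim {:G} = \dim {:Gh}.
Proof.
have <- : limg Phi = fullv.
  apply/vspaceP => u; rewrite memvf; have [x ->] := fourier_surj u.
  exact: memv_img (memvf x).
rewrite limg_dim_eq //; apply/eqP; rewrite -subv0.
have /lker0P/eqP -> := fourier_inj; exact: capvSr.
Qed.

Lemma fourier_conv x y : Phi (conv x y) = Phi x * Phi y.
Proof.
have /lfunP/(_ (tens x y)) := iso_mult Phi_fourier.
by rewrite !comp_lfunE tmap_tens mult_tens.
Qed.

Lemma fourier_hopf_integral : Phi t = 1.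
Proof.
have /lfunP/(_ (1 : C^o)) := iso_unit Phi_fourier; rewrite comp_lfunE => ->.
by rewrite unit_mapE scale1r.
Qed.

Lemma fourier_comul x : comul Gh (Phi x) = tmap Phi Phi (mult_adj G x).
Proof.
by have /lfunP/(_ x) := iso_comul Phi_fourier; rewrite !comp_lfunE.
Qed.

Lemma fourier_conv_star x : Phi (conv_star x) = star (Phi x).
Proof. exact: iso_star Phi_fourier x. Qed.

Lemma conv_hopf_integral x : conv x t = x.
Proof. by apply: fourier_inj; rewrite fourier_conv fourier_hopf_integral mulr1. Qed.

Lemma convA x y z : conv x (conv y z) = conv (conv x y) z.
Proof. by apply: fourier_inj; rewrite !fourier_conv mulrA. Qed.

(** The Haar functional of the dual is ε up to the factor n, by uniqueness of
invariant functionals. *)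
Lemma psi_fourier x : psi Gh (Phi x) = n * (counit G x : C).
Proof.
pose phi x : C^o := psi Gh (Phi x).
have phi_inv : tlift (fun b c => (phi c : C) *: b) (mult_adj G x)
    = (phi x : C) *: t.
  apply: fourier_inj; rewrite linearZ /= fourier_hopf_integral -haar_invariant.
  rewrite fourier_comul tlift_tmap => [|c k u v|b k u v].
  - by rewrite linear_tlift; apply: eq_tlift => b c /=; rewrite linearZ.
  - by rewrite scalerDr !scalerA mulrC.
  - by rewrite linearP scalerDl scalerA.
(* ε is a character and ε(t) = 1, so phi x is the value at x of ε ⊗ phi composed
   with m†, which by [tlift_mult_adj_counit] is phi (t x) = ε(x) phi t. *)
have /(congr1 (counit G)) := phi_inv.
rewrite linearZ /= counit_hopf_integral -[_ *: _]/(_ * _) mulr1.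
rewrite linear_tlift => phiE.
rewrite -[LHS]/(phi x) -phiE fourier_dim -psi1 -fourier_hopf_integral.
transitivity (phi (t * x)).
  rewrite -tlift_mult_adj_counit /phi !linear_tlift; apply: eq_tlift => b c.
  by rewrite /= !linearZ /= -[LHS]/(_ * _) -[RHS]/(_ * _) mulrC.
by rewrite hopf_integral_mul /phi !linearZ /= -[LHS]/(_ * _) mulrC.
Qed.

Lemma n_neq0 : n != 0.
Proof. exact: dim_neq0. Qed.

(** Traciality of the Haar functional on the dual makes ε(x ∗ y) symmetric. *)
Lemma psi_antipode_swap x y :
  psi G (antipode G y * x) = psi G (antipode G x * y).
Proof.
apply: (mulfI n_neq0); rewrite -!counit_conv -!psi_fourier !fourier_conv.
exact: psi_tracial.
Qed.

(** The inner product on the dual is n ε(S(x^* ) ∗ y) = n ψ(S(y) S(x^* )), and the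
symmetry of ψ(S(y) x) reduces this to n ψ(x^* y), because S S = id. *)
Lemma ip_fourier x y : ip (Phi x) (Phi y) = n * ip x y.
Proof.
rewrite /ip /ip_of -fourier_conv_star -fourier_conv psi_fourier; congr (_ * _).
by rewrite counit_conv psi_antipode_swap antipodeK.
Qed.

(** Phi intertwines the coproducts m† and Δ.  Taking adjoints turns this into a
statement on the products m and ∗; the inner product on the dual is n times the
transported one, its tensor square n^2 times. *)
Lemma conv_fourier x y : conv (Phi x) (Phi y) = n *: Phi (x * y).
Proof.
apply: (hform_eq (ip_hform Gh)) => u; have [z ->] := fourier_surj u.
rewrite -!(hformC (ip_hform Gh) _ (Phi z)); congr (_^*).
rewrite ip_conv fourier_comul tlift_tmap; [|exact: psi2_linl|exact: psi2_linr].
transitivity (n * (n * ip (x * y) z)); last first.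
  by rewrite (hformZl (ip_hform Gh)) conjC_nat ip_fourier.
rewrite mulrA /ip /ip_of starM -psi_mult_adj.
rewrite [RHS](@scaler_tlift _ _ _ C^o); apply: (@eq_tlift _ _ _ C^o) => a b.
by rewrite -![psi Gh _]/(ip (Phi _) (Phi _)) !ip_fourier mulrACA.
Qed.

(** The adjoint of [fourier_conv], with the scaling of the inner products. *)
Lemma mult_adj_fourier z :
  n *: mult_adj Gh (Phi z) = tmap Phi Phi (comul G z).
Proof.
apply: ip2_eq => u v; have [x ->] := fourier_surj u.
have [y ->] := fourier_surj v; rewrite !ip2_tensl linearZ /= psi_mult_adj tlift_tmap;
  [|exact: psi2_linl|exact: psi2_linr].
rewrite -starM -fourier_conv -[psi Gh _]/(ip (Phi _) (Phi _)) ip_fourier.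
rewrite ip_conv -[_ *: _]/(_ * _) mulrA.
rewrite [LHS](@scaler_tlift _ _ _ C^o); apply: (@eq_tlift _ _ _ C^o) => a b.
by rewrite -![psi Gh _]/(ip (Phi _) (Phi _)) !ip_fourier mulrACA.
Qed.

(** The argument is recovered at Phi 1, as A_(Phi x) (Phi 1) = n Phi x. *)
Lemma conv_op_fourier_inj : injective (fun x => conv_op (Phi x)).
Proof.
move=> x y /lfunP/(_ (Phi 1)); rewrite !conv_opE !conv_fourier !mulr1.
by move=> /(scalerI n_neq0)/fourier_inj.
Qed.

Lemma conv_op_comp x y : (conv_op x \o conv_op y)%VF = conv_op (conv x y).
Proof. by apply/lfunP => z; rewrite comp_lfunE !conv_opE convA. Qed.

Lemma conv_op_comp_fourier x y :
  (conv_op (Phi x) \o conv_op (Phi y))%VF = n *: conv_op (Phi (x * y)).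
Proof.
apply/lfunP => u; have [z ->] := fourier_surj u.
rewrite comp_lfunE scale_lfunE !conv_opE conv_fourier.
by rewrite (linear_scale (conv_linr _)) !conv_fourier mulrA.
Qed.

Lemma conv_op_one : conv_op (Phi 1) = n *: \1%VF.
Proof.
apply/lfunP => u; have [z ->] := fourier_surj u.
by rewrite conv_opE scale_lfunE id_lfunE conv_fourier mul1r.
Qed.

(** J sends Phi z to its Haar value times 1, and t z = ε(z) t. *)
Lemma conv_op_hopf_integral : conv_op (Phi t) = op_J Gh.
Proof.
apply/lfunP => u; have [z ->] := fourier_surj u.
rewrite conv_opE comp_lfunE conv_fourier hopf_integral_mul linearZ /=.
by rewrite fourier_hopf_integral scalerA -psi_fourier unit_mapE unit_adjE.
Qed.

(** This is [conv_mul_comul] over the dual, at Phi x, Phi y and Phi z. *)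
Lemma schur_conv_op x y : schur (conv_op x) (conv_op y) = conv_op (x * y).
Proof.
apply/lfunP => z; rewrite schurE conv_opE; apply: fourier_inj.
apply: (scalerI n_neq0); rewrite linear_tlift scaler_tlift.
rewrite fourier_conv scalerAl -conv_fourier -conv_mul_comul fourier_comul.
rewrite tlift_tmap => [|c k u v|b k u v].
- apply: eq_tlift => b c /=.
  by rewrite !conv_opE -!fourier_conv conv_fourier.
- by rewrite mulrDr -scalerAr conv_linl.
- by rewrite mulrDr -scalerAr conv_linr.
Qed.

(** This is [conv_mul_comul] over G, carried to the dual. *)
Lemma schur_conv_op_fourier x y :
  schur (conv_op (Phi x)) (conv_op (Phi y)) = conv_op (Phi (conv x y)).
Proof.
apply/lfunP => u; have [z ->] := fourier_surj u.
rewrite schurE !conv_opE conv_fourier -conv_mul_comul.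
apply: (scalerI n_neq0); rewrite -linearZ mult_adj_fourier /=.
rewrite tlift_tmap => [|c k v w|b k v w].
- rewrite linear_tlift !scaler_tlift; apply: eq_tlift => a b /=.
  rewrite !conv_opE !conv_fourier fourier_conv.
  by rewrite -scalerAl -scalerAr.
- by rewrite linearP mulrDl -scalerAl.
- by rewrite linearP mulrDr -scalerAr.
Qed.

(** A_x is unitarily conjugate to left multiplication by Phi x, whose adjoint is
left multiplication by (Phi x)^*. *)
Lemma dag_conv_op x : dag (conv_op x) = conv_op (conv_star x).
Proof.
apply: adjoint_eq (ip_hform G) (ip_hform G) _ => y z; rewrite !conv_opE.
apply: (mulfI n_neq0); rewrite -!ip_fourier !fourier_conv fourier_conv_star.
by rewrite /ip /ip_of starM mulrA.
Qed.

(** A_(Phi x) is unitarily conjugate to n times left multiplication by x. *)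
Lemma dag_conv_op_fourier x : dag (conv_op (Phi x)) = conv_op (Phi (star x)).
Proof.
apply: adjoint_eq (ip_hform Gh) (ip_hform Gh) _ => u v.
have [y ->] := fourier_surj u; have [z ->] := fourier_surj v.
rewrite !conv_opE !conv_fourier (hformZl (ip_hform Gh)) (hformZr (ip_hform Gh)).
by rewrite conjC_nat !ip_fourier /ip /ip_of starM !mulrA.
Qed.

End Fourier.

(** * Duality of translation schemes *)

Theorem theorem4p29 (R : realType) (G Gh : fqgroup R[i]) (Phi : 'Hom(G, Gh))
    (hPhi : fourier_transform Phi)
    (S : {vspace G}) (hS : qschur_ring S)
    (a : qassoc_scheme G) (ha : translation_scheme a)
    (haS : forall A : 'End(G),
       A \in bose_mesner a <-> exists2 x : G, x \in S & A = conv_op x) :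
  exists ah : qassoc_scheme Gh,
    [/\ translation_scheme ah,
        forall A : 'End(Gh),
          A \in bose_mesner ah <-> exists2 x : G, x \in S & A = conv_op (Phi x)
      & dual_scheme a ah].
Proof.
pose n : R[i] := (\dim {:G})%:R.
have n0 : n != 0 := n_neq0 G.
(* A_x is sent to A_(Phi x): x is recovered from A_x as its value at the unit t
   of the convolution product. *)
pose psi_op (B : 'End(G)) : 'End(Gh) := conv_op (Phi (B (hopf_integral G))).
have psi_op_linear : linear psi_op.
  move=> c A B.
  by rewrite /psi_op add_lfunE scale_lfunE linearP conv_op_linear.
pose Psi : 'Hom('End(G), 'End(Gh)) := linfun psi_op.
have PsiE x : Psi (conv_op x) = conv_op (Phi x).
  by rewrite /Psi linfunE // /psi_op conv_opE (conv_hopf_integral hPhi).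
pose L : {vspace 'End(Gh)} := (Psi @: bose_mesner a)%VS.
have LP A : A \in L <-> exists2 x : G, x \in S & A = conv_op (Phi x).
  split=> [/memv_imgP[B /haS[x xS ->] ->]|[x xS ->]].
    by exists x; rewrite ?PsiE.
  by rewrite -PsiE memv_img //; apply/haS; exists x.
have convZ c x : conv_op (Phi (c *: x)) = c *: conv_op (Phi x).
  by rewrite linearZ (linear_scale (@conv_op_linear _ Gh)).
have coh : coherent_algebra L.
  split.
  - have -> : \1%VF = n^-1 *: conv_op (Phi 1) :> 'End(Gh).
      by rewrite (conv_op_one hPhi) scalerA mulVf ?scale1r.
    by apply/memvZ/LP; exists 1; first exact: qsr_unit hS.
  - rewrite -(conv_op_hopf_integral hPhi); apply/LP.
    by exists (hopf_integral G); first exact: qsr_counit hS.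
  - move=> A B /LP[x xS ->] /LP[y yS ->]; rewrite (conv_op_comp_fourier hPhi).
    by apply/memvZ/LP; exists (x * y); first exact: (qsr_mul hS).
  - move=> A B /LP[x xS ->] /LP[y yS ->]; apply/LP; exists (conv x y).
      exact: (qsr_conv hS).
    exact: schur_conv_op_fourier.
  - move=> A /LP[x xS ->]; apply/LP; exists (star x).
      exact: (qsr_star hS).
    exact: dag_conv_op_fourier.
  - move=> A /LP[x xS ->]; apply/LP; exists (conv_star x).
      exact: (qsr_conv_star hS).
    by rewrite op_star_conv (fourier_conv_star hPhi).
have hom : homogeneous L.
  move=> A /LP[x xS ->] idem _ sub _.
  (* The condition P • I = P makes P a scalar, and P • P = P makes this scalar an
     idempotent, because ψ is a character for the convolution product. *)
  have P_scalar : conv_op (Phi x) = (psi G x : R[i]) *: \1%VF :> 'End(Gh).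
    apply: (scalerI n0); rewrite scalerA mulrC -scalerA -(conv_op_one hPhi).
    rewrite -[RHS]convZ -conv1 -(schur_conv_op_fourier hPhi) (conv_op_one hPhi).
    by rewrite schurZr sub.
  have : (psi G x : R[i]) * (psi G x : R[i]) = psi G x.
    rewrite -psi_convM; congr (psi G _).
    by apply: (conv_op_fourier_inj hPhi); rewrite -(schur_conv_op_fourier hPhi).
  move=> /eqP; rewrite -subr_eq0 -{3}[psi G x]mulr1 -mulrBr mulf_eq0 subr_eq0.
  rewrite P_scalar => /orP[] /eqP ->; rewrite ?scale0r ?scale1r; first by left.
  by right.
exists (QAssocScheme coh hom); split => //=.
  by move=> A /LP[x _ ->]; exists (Phi x).
split; first exact: fourier_dim hPhi.
exists Psi; split=> //.
- move=> A B /haS[x xS ->] /haS[y yS ->]; rewrite !PsiE.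
  by move=> /(conv_op_fourier_inj hPhi) ->.
- move=> A B /haS[x xS ->] /haS[y yS ->]; split.
    by rewrite (conv_op_comp hPhi) !PsiE (schur_conv_op_fourier hPhi).
  by rewrite (schur_conv_op hPhi) !PsiE (conv_op_comp_fourier hPhi).
- move=> A /haS[x xS ->]; split.
    by rewrite (dag_conv_op hPhi) !PsiE op_star_conv (fourier_conv_star hPhi).
  by rewrite op_star_conv !PsiE (dag_conv_op_fourier hPhi).
Qed.
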